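(* For every even integer $n\ge14$ there exist two connected, irregular, nonisomorphic graphs $G,H$ on $n$ vertices which are cospectral with respect to each of the adjacency matrix, the Laplacian matrix, the signless Laplacian matrix and the normalized Laplacian matrix, which satisfy $\alpha(G)=\alpha(H)$, $\omega(G)=\omega(H)$ and $\chi(G)=\chi(H)$, and for which $\vartheta(G)\ne\vartheta(H)$.
   Context: Graphs are finite, simple, undirected. For a graph with adjacency matrix $A$ and diagonal degree matrix $D$, the Laplacian is $L=D-A$, the signless Laplacian is $Q=D+A$, and the normalized Laplacian is $I-D^{-1/2}AD^{-1/2}$ (with $d_i^{-1/2}:=0$ for isolated vertices). Two graphs are cospectral with respect to a matrix type if those matrices have identical multisets of eigenvalues. $\alpha,\omega,\chi$ are the independence, clique and chromatic numbers; $\vartheta(G)$ is the Lovász theta function: the maximum of $\mathrm{Tr}(BJ)$ over positive semidefinite $B$ indexed by $V(G)$ with $\mathrm{Tr}B=1$ and $B_{i,j}=0$ for $\{i,j\}\in E(G)$, $J$ the all-ones matrix. Irregular means not all vertex degrees are equal. *)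

(* Defs.v *)
From HB Require Import structures.
From mathcomp Require Import all_boot all_order all_fingroup all_algebra.
From mathcomp Require Import classical_sets reals.
Set Implicit Arguments. Unset Strict Implicit. Unset Printing Implicit Defensive.
Import Order.TTheory GRing.Theory Num.Theory.
Local Open Scope ring_scope.

Definition simple_graph (n : nat) (G : rel 'I_n) : Prop :=
  symmetric G /\ irreflexive G.

Definition deg (n : nat) (G : rel 'I_n) (v : 'I_n) : nat := #|[set w | G v w]|.

Definition connected_graph (n : nat) (G : rel 'I_n) : Prop :=
  forall x y : 'I_n, connect G x y.

Definition irregular (n : nat) (G : rel 'I_n) : Prop :=
  exists x y : 'I_n, deg G x <> deg G y.

Definition isomorphic (n : nat) (G H : rel 'I_n) : Prop :=
  exists f : {perm 'I_n}, forall x y, G x y = H (f x) (f y).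

Definition adjmx (R : realType) (n : nat) (G : rel 'I_n) : 'M[R]_n :=
  \matrix_(i, j) (G i j)%:R.
Definition degmx (R : realType) (n : nat) (G : rel 'I_n) : 'M[R]_n :=
  \matrix_(i, j) ((i == j)%:R * (deg G i)%:R).
Definition laplacian (R : realType) (n : nat) (G : rel 'I_n) : 'M[R]_n :=
  degmx R G - adjmx R G.
Definition signless_laplacian (R : realType) (n : nat) (G : rel 'I_n) : 'M[R]_n :=
  degmx R G + adjmx R G.
Definition dinvsqrt (R : realType) (n : nat) (G : rel 'I_n) (i : 'I_n) : R :=
  if deg G i == 0%N then 0 else (Num.sqrt (deg G i)%:R)^-1.
Definition norm_laplacian (R : realType) (n : nat) (G : rel 'I_n) : 'M[R]_n :=
  1%:M - (diag_mx (\row_i dinvsqrt R G i) *m adjmx R G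
            *m diag_mx (\row_i dinvsqrt R G i)).

(* Cospectral: identical multisets of eigenvalues, i.e. identical
   characteristic polynomials. *)
Definition cospectral (R : realType) (n : nat) (A B : 'M[R]_n) : Prop :=
  char_poly A = char_poly B.

Definition independent (n : nat) (G : rel 'I_n) (S : {set 'I_n}) : bool :=
  [forall x in S, forall y in S, ~~ G x y].
Definition clique (n : nat) (G : rel 'I_n) (S : {set 'I_n}) : bool :=
  [forall x in S, forall y in S, (x != y) ==> G x y].
Definition alpha (n : nat) (G : rel 'I_n) : nat :=
  \max_(S : {set 'I_n} | independent G S) #|S|.
Definition omega (n : nat) (G : rel 'I_n) : nat :=
  \max_(S : {set 'I_n} | clique G S) #|S|.
Definition colorable (n : nat) (G : rel 'I_n) (k : nat) : bool :=
  [exists f : {ffun 'I_n -> 'I_k}, forall x, forall y, G x y ==> (f x != f y)].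
(* least k admitting a proper k-colouring (n colours always suffice) *)
Definition chi (n : nat) (G : rel 'I_n) : nat :=
  \big[minn/n]_(k < n.+1 | colorable G k) k.

Definition psd (R : realType) (n : nat) (B : 'M[R]_n) : Prop :=
  B^T = B /\ forall x : 'cV[R]_n, 0 <= (x^T *m B *m x) ord0 ord0.
Definition theta (R : realType) (n : nat) (G : rel 'I_n) : R :=
  sup [set t : R | exists B : 'M[R]_n,
         [/\ psd B, \tr B = 1,
             (forall i j, G i j -> B i j = 0) &
             t = \tr (B *m const_mx 1)]].

(* Main.v *)
Require Import Defs.
From mathcomp Require Import all_boot all_order all_fingroup all_algebra.
From mathcomp Require Import boolp classical_sets reals.
From mathcomp Require Import ring lra zify.
Set Implicit Arguments. Unset Strict Implicit. Unset Printing Implicit Defensive.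
Import Order.TTheory GRing.Theory Num.Theory.
Local Open Scope ring_scope.

(** G and H are the joins with K_m (m = n - 10) of two graphs on 10 vertices
    which differ by a Godsil-McKay switching with respect to the clique
    C = {0,1,2,3}: vertices 4..9 are joined to the six 2-subsets of C in one
    graph and to the complementary 2-subsets in the other. The switching matrix,
    (2/|C|) J - I on C and I elsewhere, conjugates the adjacency matrices; as
    the switching preserves degrees and all vertices of C have the same degree,
    it also intertwines every function of the degree matrices, which gives
    cospectrality for all four matrices.
    The vertices of G are covered by 3 cliques, hence theta(G) <= 3, whereas H
    contains an induced C5 + K1, whence theta(H) >= 512/159 > 3. This also rules
    out an isomorphism. Both graphs have alpha = 3 and omega = chi = m + 4. *)

(** * Godsil-McKay switching and cospectrality *)

Definition switch_mx (R : realType) (n : nat) (C : {set 'I_n}) : 'M[R]_n :=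
  \matrix_(i, j) if (i \in C) && (j \in C) then 2 / #|C|%:R - (i == j)%:R
                 else (i == j)%:R.

Lemma tr_switch_mx (R : realType) n (C : {set 'I_n}) :
  (switch_mx R C)^T = switch_mx R C.
Proof. by apply/matrixP=> i j; rewrite !mxE andbC eq_sym. Qed.

Lemma mul_switch_mx (R : realType) n p (C : {set 'I_n}) (A : 'M[R]_(n, p)) i j :
  (switch_mx R C *m A) i j =
  if i \in C then 2 / #|C|%:R * (\sum_(k in C) A k j) - A i j else A i j.
Proof.
rewrite mxE; case: ifPn => iC; last first.
  rewrite (bigD1 i) //= mxE (negbTE iC) eqxx mul1r big1 ?addr0 // => k ki.
  by rewrite mxE (negbTE iC) /= eq_sym (negbTE ki) mul0r.
rewrite [in RHS]big_mkcond mulr_sumr /=.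
have -> : A i j = \sum_k (i == k)%:R * A k j.
  rewrite (bigD1 i) //= eqxx mul1r big1 ?addr0 // => k ki.
  by rewrite eq_sym (negbTE ki) mul0r.
rewrite -sumrB; apply: eq_bigr => k _; rewrite mxE iC /=.
case: ifPn => kC; first by rewrite mulrBl.
case: eqP => [ik|_]; first by rewrite -ik iC in kC.
by rewrite !mul0r mulr0 subr0.
Qed.

Lemma mulmx_switch (R : realType) n p (C : {set 'I_n}) (A : 'M[R]_(p, n)) i j :
  (A *m switch_mx R C) i j =
  if j \in C then 2 / #|C|%:R * (\sum_(k in C) A i k) - A i j else A i j.
Proof.
have -> : A *m switch_mx R C = (switch_mx R C *m A^T)^T.
  by rewrite trmx_mul trmxK tr_switch_mx.
rewrite mxE mul_switch_mx mxE; case: ifP => // _.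
by congr (_ * _ - _); apply: eq_bigr => k _; rewrite mxE.
Qed.

(** With J the all-ones block on [C] and c its size, J^2 = c J, so (2/c) J - I squares to I. *)
Lemma switch_mxK (R : realType) n (C : {set 'I_n}) :
  (0 < #|C|)%N -> switch_mx R C *m switch_mx R C = 1%:M.
Proof.
move=> C0; apply/matrixP=> i j; rewrite mul_switch_mx !mxE.
have [iC|iC] := boolP (i \in C) => //=.
have [jC|jC] := boolP (j \in C) => /=; last first.
  rewrite big1 ?mulr0 ?sub0r.
    by case: eqP => [ij|_]; [rewrite -ij iC in jC | rewrite oppr0].
  move=> k kC; rewrite mxE (negbTE jC) andbF.
  by case: eqP => [kj|//]; rewrite -kj kC in jC.
under eq_bigr => k kC do rewrite mxE kC jC /=.
rewrite sumrB sumr_const (bigD1 j) //= eqxx big1 ?addr0.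
  have cN0 : #|C|%:R != 0 :> R by rewrite pnatr_eq0 -lt0n.
  by rewrite -[X in X - 1]mulr_natr; field.
by move=> k /andP[_ /negbTE->].
Qed.

(** Similarity in inverse-free form: U (X - A) = (X - B) U over the polynomials, and the nonzero
    constant det U cancels from the determinants. *)
Lemma intertwined_cospectral (R : realType) n (U : 'M[R]_n) (A B : 'M[R]_n) :
  U \in unitmx -> U *m A = B *m U -> cospectral A B.
Proof.
move=> Uu UA; pose V := map_mx polyC U.
have VA : V *m char_poly_mx A = char_poly_mx B *m V.
  by rewrite mulmxBr mulmxBl -scalar_mxC -!map_mxM /= UA.
apply: (mulfI (_ : \det V != 0)).
  by rewrite det_map_mx polyC_eq0 -unitfE -unitmxE.
by rewrite /char_poly -det_mulmx VA det_mulmx mulrC.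
Qed.

(** [U] links only vertices of equal degree. As [h] is arbitrary, this serves for D and for D^(-1/2)
    alike. *)
Lemma intertwined_diag (R : realType) n (U : 'M[R]_n) (G H : rel 'I_n)
    (h : nat -> R) :
  (forall i j, U i j != 0 -> deg H i = deg G j) ->
  U *m diag_mx (\row_i h (deg G i)) = diag_mx (\row_i h (deg H i)) *m U.
Proof.
move=> Udeg; apply/matrixP=> i j; rewrite mul_mx_diag mul_diag_mx !mxE mulrC.
by have [->|/Udeg->] := eqVneq (U i j) 0; rewrite ?mulr0.
Qed.

Lemma degmxE (R : realType) n (G : rel 'I_n) :
  degmx R G = diag_mx (\row_i (deg G i)%:R).
Proof.
apply/matrixP=> i j; rewrite !mxE.
by case: eqP => [->|_]; rewrite ?mul1r ?mulr1n ?mul0r.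
Qed.

(** The identity for [j] outside [C] covers both kinds of vertices in a switching: those adjacent to
    half of [C], whose adjacencies to [C] are complemented, and those adjacent to none or all of
    [C], which are left alone. *)
Lemma switching_cospectral (R : realType) n (C : {set 'I_n}) (G H : rel 'I_n) :
    symmetric G -> symmetric H -> (0 < #|C|)%N ->
    (forall i j, (i \in C) = (j \in C) -> G i j = H i j) ->
    (forall i j, i \in C -> j \in C ->
      \sum_(k in C) G i k = \sum_(k in C) G j k)%N ->
    (forall i j, i \in C -> j \notin C ->
      (\sum_(k in C) G k j) * 2 = #|C| * (G i j + H i j))%N ->
    (forall i, deg G i = deg H i) ->
    (forall i j, i \in C -> j \in C -> deg G i = deg G j) ->
  [/\ cospectral (adjmx R G) (adjmx R H),
      cospectral (laplacian R G) (laplacian R H),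
      cospectral (signless_laplacian R G) (signless_laplacian R H) &
      cospectral (norm_laplacian R G) (norm_laplacian R H)].
Proof.
move=> symG symH C0 eqGH regC halfC degGH degC.
pose U := switch_mx R C.
have cN0 : #|C|%:R != 0 :> R by rewrite pnatr_eq0 -lt0n.
have Uu : U \in unitmx by case/mulmx1_unit: (switch_mxK R C0).
have half i j : i \in C -> j \notin C ->
    2 / #|C|%:R * (\sum_(k in C) (G k j)%:R) = (G i j)%:R + (H i j)%:R :> R.
  move=> iC jC; have := halfC i j iC jC => /(congr1 (fun t : nat => t%:R : R)).
  rewrite !natrM natrD natr_sum => E.
  by apply: (mulfI cN0); rewrite -E; field.
have UA : U *m adjmx R G = adjmx R H *m U.
  apply/matrixP=> i j; rewrite mul_switch_mx mulmx_switch !mxE.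
  under eq_bigr => k _ do rewrite mxE.
  under [in RHS]eq_bigr => k _ do rewrite mxE.
  have [iC|iC] := boolP (i \in C); have [jC|jC] := boolP (j \in C).
  - rewrite (eqGH i j) ?iC ?jC //; congr (_ * _ - _).
    rewrite -!natr_sum; congr (_%:R).
    under eq_bigr => k _ do rewrite symG.
    rewrite (regC _ _ jC iC); apply: eq_bigr => k kC.
    by rewrite eqGH // iC kC.
  - by rewrite (half i j) // addrC addrA addNr add0r.
  - have := half j i jC iC.
    (* Summing [half] over [C] gives 2s = s + t for the numbers s, t of neighbours of [i] in [C]
       under [G] and [H]; hence s = t. *)
    have -> : \sum_(k in C) (G k i)%:R = \sum_(k in C) (H i k)%:R :> R.
      have E : \sum_(k in C) (2 / #|C|%:R * (\sum_(l in C) (G l i)%:R)) =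
               \sum_(k in C) (G k i)%:R + \sum_(k in C) (H i k)%:R :> R.
        rewrite -big_split; apply: eq_bigr => k kC /=.
        by rewrite (half k i) // (symH k i).
      rewrite sumr_const -[X in X = _]mulr_natr in E.
      set s := \sum_(k in C) _ in E *; set t := \sum_(k in C) _ in E *.
      have {}E : 2 * s = s + t by rewrite -E; field.
      lra.
    by move=> ->; rewrite (symG j i) (symH j i) addrK.
  - by rewrite eqGH // (negbTE iC) (negbTE jC).
have Udeg i j : U i j != 0 -> deg H i = deg G j.
  rewrite mxE -degGH; case: ifP => [/andP[iC jC] _|_]; first exact: degC.
  by case: (i =P j) => [->|]; rewrite ?eqxx.
have UD := @intertwined_diag R n U G H (fun d => d%:R) Udeg.
have UN := @intertwined_diag R n U G H
  (fun d => if d == 0%N then 0 else (Num.sqrt d%:R)^-1) Udeg.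
split; apply: (intertwined_cospectral Uu) => //.
- by rewrite /laplacian !degmxE mulmxBr mulmxBl UA UD.
- by rewrite /signless_laplacian !degmxE mulmxDr mulmxDl UA UD.
- rewrite /norm_laplacian mulmxBr mulmxBl mulmx1 mul1mx; congr (_ - _).
  by rewrite !mulmxA UN -(mulmxA _ U) UA !mulmxA -(mulmxA _ U) UN !mulmxA.
Qed.

(** * Clique and chromatic numbers *)

(** A proper colouring is injective on cliques: [g] bounds every clique by k, and the clique [f]
    forces at least k colours. The bound k <= n also handles the default value n of the minimum in
    [chi]. *)
Lemma omega_chi_eq n k (G : rel 'I_n) (f : 'I_k -> 'I_n) (g : 'I_n -> 'I_k) :
  (forall i j, i != j -> G (f i) (f j)) -> injective f ->
  (forall x y, G x y -> g x != g y) -> irreflexive G -> (k <= n)%N ->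
  omega G = k /\ chi G = k.
Proof.
move=> cl fI col irr kn; split.
  apply/eqP; rewrite eqn_leq; apply/andP; split.
    apply/bigmax_leqP => S clS; rewrite -[leqRHS]card_ord.
    rewrite -(card_in_imset (f := g)) ?max_card // => x y xS yS gxy.
    apply/eqP; apply: contraTT (clS) => xy; apply/forall_inPn.
    exists x => //; apply/forall_inPn; exists y => //.
    by rewrite negb_imply xy; apply/negP => /col; rewrite gxy eqxx.
  have -> : k = #|[set f i | i : 'I_k]| by rewrite card_imset // card_ord.
  apply: leq_bigmax_cond; apply/forall_inP => _ /imsetP[i _ ->].
  apply/forall_inP => _ /imsetP[j _ ->]; apply/implyP => fij.
  by apply: cl; apply: contraNneq fij => ->.
apply/eqP; rewrite eqn_leq; apply/andP; split.
  rewrite /chi -minEnat.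
  have kn1 : (k < n.+1)%N by [].
  apply: (@Order.TotalTheory.bigmin_le_cond _ nat _ n (Ordinal kn1)).
  apply/existsP; exists [ffun x => g x]; apply/forallP => x; apply/forallP => y.
  by apply/implyP => /col; rewrite !ffunE.
rewrite /chi; elim/big_ind: _ => // [a b ka kb|j /existsP[h hP]].
  by rewrite leq_min ka kb.
have hfI : injective (h \o f).
  move=> i i' /eqP hii; apply/eqP; apply: contraTT hii => /cl.
  by move/forallP/(_ (f i))/forallP/(_ (f i'))/implyP: hP; apply.
by have := leq_card _ hfI; rewrite !card_ord.
Qed.

(** * Bounds on the theta function *)

Lemma quadratic_formE (R : realType) n (B : 'M[R]_n) (x : 'cV[R]_n) :
  (x^T *m B *m x) ord0 ord0 = \sum_i \sum_j x i ord0 * B i j * x j ord0.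
Proof.
rewrite mxE exchange_big; apply: eq_bigr => j _; rewrite mxE mulr_suml.
by apply: eq_bigr => i _; rewrite mxE.
Qed.

Lemma trace_allones (R : realType) n (B : 'M[R]_n) :
  \tr (B *m const_mx 1) = \sum_i \sum_j B i j.
Proof.
rewrite /mxtrace; apply: eq_bigr => i _; rewrite mxE.
by apply: eq_bigr => j _; rewrite mxE mulr1.
Qed.

(** Stated for a single feasible [B], it yields both the upper bound on [theta] and, with single
    vertices as classes, the boundedness of the set whose supremum is [theta]. *)
Lemma clique_cover_bound (R : realType) n k (G : rel 'I_n) (c : 'I_n -> 'I_k)
    (B : 'M[R]_n) :
    (forall x y, x != y -> c x = c y -> G x y) ->
    psd B -> \tr B = 1 -> (forall i j, G i j -> B i j = 0) ->
  \tr (B *m const_mx 1) <= k%:R.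
Proof.
move=> cl [_ psdB] trB B0; rewrite trace_allones.
(* Without classes there are no vertices, and the sum is empty. *)
case: k c cl => [c _|k c cl]; first by rewrite big1 // => i; case: (c i).
set K : R := k.+1%:R; set s := \sum_i _.
have K0 : 0 < K by rewrite ltr0n.
have delta (a : 'I_k.+1) : \sum_b (a == b)%:R = 1 :> R.
  rewrite (bigD1 a) //= eqxx big1 ?addr0 // => b ba.
  by rewrite eq_sym (negbTE ba).
(* The vectors k 1_{c = a} - 1, a < k: their quadratic forms sum to
   k (k tr B - tr (B J)), because the off-diagonal entries of B within a class
   of c vanish. *)
pose v a : 'cV[R]_n := \col_i (K * (c i == a)%:R - 1).
have : 0 <= \sum_a ((v a)^T *m B *m v a) ord0 ord0.
  by apply: sumr_ge0 => a _; apply: psdB.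
suff -> : \sum_a ((v a)^T *m B *m v a) ord0 ord0 = K * (K - s).
  by rewrite pmulr_rge0 // subr_ge0.
under eq_bigr => a _ do rewrite quadratic_formE.
rewrite exchange_big /=.
transitivity (\sum_i (K ^+ 2 * B i i - K * \sum_j B i j)); last first.
  rewrite sumrB -!mulr_sumr -/(\tr B) trB -/s; ring.
apply: eq_bigr => i _; rewrite exchange_big /=.
have -> : B i i = \sum_j (c i == c j)%:R * B i j.
  rewrite (bigD1 i) //= eqxx mul1r big1 ?addr0 // => j ji.
  case: eqP => [cij|_]; last by rewrite mul0r.
  by rewrite B0 ?mulr0 //; apply: cl; rewrite // eq_sym.
rewrite !mulr_sumr -sumrB; apply: eq_bigr => j _.
transitivity (\sum_a (K ^+ 2 * B i j * ((c i == a)%:R * (c j == a)%:R)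
    - K * B i j * (c i == a)%:R - K * B i j * (c j == a)%:R + B i j)).
  by apply: eq_bigr => a _; rewrite !mxE; ring.
rewrite big_split sumrB sumrB -!mulr_sumr !delta sumr_const card_ord /=.
have -> : \sum_a (c i == a)%:R * (c j == a)%:R = (c i == c j)%:R :> R.
  rewrite (bigD1 (c i)) //= eqxx mul1r big1 ?addr0; first by rewrite eq_sym.
  by move=> a; rewrite eq_sym => /negbTE ->; rewrite mul0r.
by rewrite -mulr_natl -/K; ring.
Qed.

Lemma theta_le_clique_cover (R : realType) n k (G : rel 'I_n)
    (c : 'I_n -> 'I_k) :
  (forall x y, x != y -> c x = c y -> G x y) -> theta R G <= k%:R.
Proof.
move=> cl; rewrite /theta; set E := [set t | _]%classic.
have ubE : ubound E k%:R.
  by move=> _ [B [pB tB B0 ->]]; apply: clique_cover_bound cl pB tB B0.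
have [neE|] := pselect (E !=set0)%classic; first exact: ge_sup.
(* The supremum of an empty feasible set is 0 by convention. *)
by move=> neE; rewrite sup_out // => -[].
Qed.

Lemma theta_ge (R : realType) n (G : rel 'I_n) (B : 'M[R]_n) :
    psd B -> \tr B = 1 -> (forall i j, G i j -> B i j = 0) ->
  \tr (B *m const_mx 1) <= theta R G.
Proof.
move=> pB tB B0; apply: ub_le_sup; last by exists B; split.
(* A supremum dominates its set only if the set is bounded; the cover by single vertices gives the
   bound n. *)
exists n%:R => _ [A [pA tA A0 ->]].
by apply: (@clique_cover_bound _ _ _ G id) => // x y /eqP.
Qed.

(** The columns of [V] are vectors attached to the vertices, orthogonal along edges. Their Gram
    matrix, scaled to trace 1, is feasible, and its entries sum to the squared norm of the sum of
    the vectors over the total of their squared norms. *)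
Lemma theta_ge_gram (R : realType) k n (G : rel 'I_n) (V : 'M[R]_(k, n)) :
    (forall i j, G i j -> \sum_l V l i * V l j = 0) ->
    0 < \sum_l \sum_i V l i ^+ 2 ->
  (\sum_l (\sum_i V l i) ^+ 2) / (\sum_l \sum_i V l i ^+ 2) <= theta R G.
Proof.
move=> orth; set t := \sum_l \sum_i _ => t0.
pose B := t^-1 *: (V^T *m V).
have BE i j : B i j = t^-1 * \sum_l V l i * V l j.
  by rewrite !mxE; congr (_ * _); apply: eq_bigr => l _; rewrite mxE.
have <- : \tr (B *m const_mx 1) = (\sum_l (\sum_i V l i) ^+ 2) / t.
  rewrite trace_allones mulrC.
  transitivity (t^-1 * \sum_i \sum_j \sum_l V l i * V l j).
    rewrite mulr_sumr; apply: eq_bigr => i _; rewrite mulr_sumr.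
    by apply: eq_bigr => j _; rewrite BE.
  congr (_ * _); under eq_bigr => i _ do rewrite exchange_big.
  rewrite exchange_big; apply: eq_bigr => l _ /=.
  rewrite expr2 mulr_suml; apply: eq_bigr => i _.
  by rewrite mulr_sumr.
apply: theta_ge.
- split=> [|x]; first by rewrite /B linearZ /= trmx_mul trmxK.
  rewrite /B -scalemxAr -scalemxAl mxE mulr_ge0 ?invr_ge0 ?(ltW t0) //.
  have -> : x^T *m (V^T *m V) *m x = (V *m x)^T *m (V *m x).
    by rewrite trmx_mul !mulmxA.
  rewrite mxE.
  by apply: sumr_ge0 => l _; rewrite mxE -expr2 sqr_ge0.
- rewrite /mxtrace; under eq_bigr => i _ do rewrite BE.
  rewrite -mulr_sumr exchange_big /=.
  under eq_bigr => l _ do under eq_bigr => i _ do rewrite -expr2.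
  by rewrite mulVf // gt_eqF.
- by move=> i j /orth Gij; rewrite BE Gij mulr0.
Qed.

(** * Joins of a ten-vertex core with a complete graph of apexes *)

(* The join of the graph on {0..9} with edge list [e] and the complete graph on
   the vertices from 10 on. *)
Definition cone_rel (e : seq (nat * nat)) : rel nat := fun x y =>
  if (x < 10)%N && (y < 10)%N then ((x, y) \in e) || ((y, x) \in e) else x != y.

(** As [cone_rel] lives on [nat], properties of the core are decided by computation over
    [iota 0 10], uniformly in [m]. *)
Definition cone (m : nat) (e : seq (nat * nat)) : rel 'I_(10 + m) :=
  fun x y => cone_rel e x y.

(** Trades the locked big operator for a fold that evaluates. *)
Lemma big_ord_foldr T (op : T -> T -> T) idx n (F : nat -> T) :
  \big[op/idx]_(i < n) F i = foldr (fun i s => op (F i) s) idx (iota 0 n).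
Proof. by rewrite -(big_mkord xpredT F) /index_iota subn0 unlock. Qed.

Lemma all_iota_lt n (P : pred nat) :
  all P (iota 0 n) -> forall x, (x < n)%N -> P x.
Proof. by move=> /allP allP x xn; apply: allP; rewrite mem_iota. Qed.

Lemma all2_iota_lt n (P : rel nat) :
  all (fun x => all (P x) (iota 0 n)) (iota 0 n) ->
  forall x y, (x < n)%N -> (y < n)%N -> P x y.
Proof. by move=> /all_iota_lt P2 x y /P2 /all_iota_lt; apply. Qed.

Lemma cone_sym m e : symmetric (@cone m e).
Proof. by move=> x y; rewrite /cone /cone_rel andbC orbC eq_sym. Qed.

Lemma cone_irr m e :
  all (fun x => ~~ cone_rel e x x) (iota 0 10) -> irreflexive (@cone m e).
Proof.
move=> /all_iota_lt irr x; apply/negbTE; have [/irr//|x10] := ltnP x 10.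
by rewrite /cone /cone_rel ltnNge x10 /= eqxx.
Qed.

Lemma cone_apex m e (x y : 'I_(10 + m)) :
  (10 <= x)%N || (10 <= y)%N -> cone e x y = (x != y).
Proof. by rewrite /cone /cone_rel; case: (ltnP x); case: (ltnP y). Qed.

(** Vertex 10 is an apex, adjacent to every other vertex. *)
Lemma connected_cone m e : (0 < m)%N -> connected_graph (@cone m e).
Proof.
move=> m0 x y; have a10 : (10 < 10 + m)%N by lia.
pose a := Ordinal a10.
have apex z : connect (@cone m e) a z.
  have [->|az] := eqVneq a z; first exact: connect0.
  by apply: connect1; rewrite cone_apex.
by apply: connect_trans (apex y); rewrite (sym_connect_sym (@cone_sym m e)).
Qed.

Lemma degE n (G : rel 'I_n) x : deg G x = (\sum_y G x y)%N.
Proof. by rewrite /deg -sum1dep_card big_mkcond. Qed.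

Lemma deg_cone m e (x : 'I_(10 + m)) : deg (cone e) x =
  (if (x < 10)%N then foldr (fun y s => cone_rel e x y + s) 0 (iota 0 10) + m
   else 9 + m)%N.
Proof.
rewrite degE; case: ltnP => x10.
  rewrite big_split_ord -big_ord_foldr /=; congr (_ + _)%N.
  rewrite (eq_bigr (fun=> 1%N)) ?sum1_card ?card_ord // => i _.
  rewrite cone_apex /= ?leq_addr ?orbT //.
  by rewrite -val_eqE /= (ltn_eqF (leq_trans x10 (leq_addr _ _))).
rewrite (eq_bigr (fun y => (y != x) : nat)); last first.
  by move=> y _; rewrite cone_apex ?x10 // eq_sym.
rewrite -big_mkcond sum1dep_card.
have -> : [set y | y != x] = [set~ x] by apply/setP => y; rewrite !inE.
by rewrite cardsC1 card_ord.
Qed.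

(** An apex lies in no independent set with a second vertex, so four independent vertices would all
    lie in the core, where a finite check excludes them. *)
Lemma alpha_cone m e (a b c : nat) :
    all (fun x => all (fun y => all (fun z => all (fun t =>
      ~~ [&& uniq [:: x; y; z; t], ~~ cone_rel e x y, ~~ cone_rel e x z,
         ~~ cone_rel e x t, ~~ cone_rel e y z, ~~ cone_rel e y t
         & ~~ cone_rel e z t])
      (iota 0 10)) (iota 0 10)) (iota 0 10)) (iota 0 10) ->
    all (fun x => all (fun y => ~~ cone_rel e x y) [:: a; b; c]) [:: a; b; c] ->
    all (fun x => x < 10)%N [:: a; b; c] -> uniq [:: a; b; c] ->
  alpha (@cone m e) = 3%N.
Proof.
move=> no4 ind3 /and4P[a10 b10 c10 _] uabc.
apply/eqP; rewrite eqn_leq; apply/andP; split.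
  apply/bigmax_leqP => S /forall_inP indS; rewrite leqNgt; apply/negP.
  move=> /card_geqP[[|x [|y [|z [|t [|? ?]]]]] [us ss sub]] //.
  have {}indS u v : u \in [:: x; y; z; t] -> v \in [:: x; y; z; t] ->
      ~~ cone_rel e u v.
    by move=> /sub /indS /forall_inP h /sub /h.
  have core u v : u \in [:: x; y; z; t] -> v \in [:: x; y; z; t] -> u != v ->
      (u < 10)%N.
    move=> us' vs uv; rewrite ltnNge; apply/negP => u10.
    by have := indS u v us' vs; rewrite -/(cone e u v) cone_apex ?u10 ?uv.
  have xyzt : [&& x != y, x != z, x != t, y != z, y != t & z != t].
    by move: us; rewrite /= !inE !negb_or -!andbA andbT.
  case/and5P: (xyzt) => xy xz xt yz /andP[yt zt].
  have mx : x \in [:: x; y; z; t] by rewrite !inE eqxx ?orbT.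
  have my : y \in [:: x; y; z; t] by rewrite !inE eqxx ?orbT.
  have mz : z \in [:: x; y; z; t] by rewrite !inE eqxx ?orbT.
  have mt : t \in [:: x; y; z; t] by rewrite !inE eqxx ?orbT.
  have x10 := core x y mx my xy; have z10 := core z t mz mt zt.
  have y10 : (y < 10)%N by apply: (core y x my mx); rewrite eq_sym.
  have t10 : (t < 10)%N by apply: (core t z mt mz); rewrite eq_sym.
  have /negP[] := all_iota_lt (all_iota_lt (all_iota_lt (all_iota_lt no4
    x10) y10) z10) t10.
  rewrite (map_inj_uniq val_inj [:: x; y; z; t]) us.
  by rewrite !indS.
pose lt i := (i < 10 + m)%N.
have [a10m b10m c10m] : [/\ lt a, lt b & lt c].
  by split; apply: leq_trans (leq_addr _ _).
pose s := [:: Ordinal a10m; Ordinal b10m; Ordinal c10m].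
have ms : map val s = [:: a; b; c] by [].
have cs : #|[set i in s]| = 3%N.
  by rewrite cardsE; apply/card_uniqP; rewrite -(map_inj_uniq val_inj).
rewrite -[leqLHS]cs; apply: leq_bigmax_cond.
apply/forall_inP => x; rewrite inE => xs; apply/forall_inP => y; rewrite inE => ys.
by move/allP/(_ _ (map_f val xs))/allP/(_ _ (map_f val ys)): ind3.
Qed.

Lemma omega_chi_cone m e (col : seq nat) :
    all (fun x => ~~ cone_rel e x x) (iota 0 10) ->
    all (fun x => all (fun y => (x != y) ==> cone_rel e x y) (iota 0 4))
      (iota 0 4) ->
    all (fun x => nth 0%N col x < 4)%N (iota 0 10) ->
    all (fun x => all (fun y => cone_rel e x y ==> (nth 0 col x != nth 0 col y)%N)
      (iota 0 10)) (iota 0 10) ->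
  omega (@cone m e) = (4 + m)%N /\ chi (@cone m e) = (4 + m)%N.
Proof.
move=> irr /all2_iota_lt K4 /all_iota_lt col4 /all2_iota_lt colP.
(* The clique consists of 0..3 and all apexes, and each apex gets a colour of its own. The shift 6 =
   10 - 4 matches the apexes, from 10 on, with the clique indices and colours from 4 on. *)
have fP (i : 'I_(4 + m)) : ((if i < 4 then nat_of_ord i else i + 6) < 10 + m)%N.
  by have := ltn_ord i; case: ifP; lia.
have gP (x : 'I_(10 + m)) :
    ((if x < 10 then nth 0 col x else x - 6) < 4 + m)%N.
  have xm := ltn_ord x; case: (ltnP x 10) => [/col4|] h; first exact: ltn_addr.
  by lia.
have fI : injective (fun i => Ordinal (fP i)).
  by move=> i j [] h; apply: val_inj => /=; move: h; case: (ltnP i 4); case: (ltnP j 4); lia.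
apply: (@omega_chi_eq _ _ _ (fun i => Ordinal (fP i)) (fun x => Ordinal (gP x))).
- move=> i j ij; have [/andP[i4 j4]|] := boolP ((i < 4) && (j < 4))%N.
    by move/implyP: (K4 _ _ i4 j4); rewrite /cone /= i4 j4; apply.
  rewrite negb_and -[in X in X || _]leqNgt -[in X in _ || X]leqNgt => ij4.
  rewrite cone_apex.
    by apply: contraNneq ij => /fI ->.
  by move: ij4 => /=; case: (ltnP i 4); case: (ltnP j 4); lia.
- exact: fI.
- move=> x y; have [/andP[x10 y10]|] := boolP ((x < 10) && (y < 10))%N.
    move=> xy; rewrite -val_eqE /= x10 y10.
    by move/implyP: (colP _ _ x10 y10); apply.
  rewrite negb_and -[in X in X || _]leqNgt -[in X in _ || X]leqNgt => xy10.
  rewrite cone_apex //.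
  move=> xy; apply: contraNneq xy => -[] h; apply/eqP/val_inj; move: h => /=.
  case: (ltnP x 10) => x10; case: (ltnP y 10) => y10.
  + by move: xy10; lia.
  + by have := col4 _ x10; lia.
  + by have := col4 _ y10; lia.
  + by lia.
- exact: cone_irr.
- by lia.
Qed.

(** * The two graphs and their theta bounds *)

(** A K4 on 0..3, a house on 4..8 (triangle 4, 5, 6 on top of the square 5, 6, 8, 7), and the vertex
    9. *)
Definition core_edges : seq (nat * nat) :=
  [:: (0, 1); (0, 2); (0, 3); (1, 2); (1, 3); (2, 3);
      (4, 5); (4, 6); (5, 6); (5, 7); (6, 8); (7, 8)]%N.

Definition edgesG : seq (nat * nat) := core_edges ++
  [:: (0, 4); (1, 4); (0, 5); (2, 5); (0, 6); (3, 6);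
      (1, 7); (2, 7); (1, 8); (3, 8); (2, 9); (3, 9)]%N.

Definition edgesH : seq (nat * nat) := core_edges ++
  [:: (2, 4); (3, 4); (1, 5); (3, 5); (1, 6); (2, 6);
      (0, 7); (3, 7); (0, 8); (2, 8); (0, 9); (1, 9)]%N.

(* The permutation lets the bound apply both to G itself and, for refuting an
   isomorphism from G to H, to H. *)
Lemma theta_le_coneG (R : realType) m (H : rel 'I_(10 + m)) :
  (exists f : {perm 'I_(10 + m)}, forall x y, cone edgesG x y -> H (f x) (f y)) ->
  theta R H <= 3.
Proof.
(* The classes are the cliques {0, 4, 5, 6}, {1, 7, 8} and {2, 3, 9} of G; the default value 0 of
   [nth] puts the apexes into the first one. *)
move=> [f fP]; pose c := [:: 0; 1; 2; 2; 0; 0; 0; 1; 1; 2]%N.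
have c3 x : (nth 0 c x < 3)%N.
  have [x10|x10] := ltnP x 10; last by rewrite nth_default.
  by apply: (@all_iota_lt 10 (fun x => (nth 0 c x < 3)%N)).
have cP : forall x y, (x < 10)%N -> (y < 10)%N ->
    [|| x == y, (nth 0 c x != nth 0 c y)%N | cone_rel edgesG x y].
  by apply: all2_iota_lt; vm_compute.
apply: (@theta_le_clique_cover _ _ 3 _ (fun x => Ordinal (c3 (f^-1 x)%g))).
move=> x y xy [] cxy; rewrite -[x](permKV f) -[y](permKV f); apply: fP.
have {xy} : (f^-1 x)%g != (f^-1 y)%g by rewrite (inj_eq perm_inj).
move: (f^-1 x)%g (f^-1 y)%g cxy => {}x {}y cxy xy.
have [x10|x10] := ltnP x 10; last by rewrite cone_apex ?x10.
have [y10|y10] := ltnP y 10; last by rewrite cone_apex ?y10 ?orbT.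
by have := cP x y x10 y10; rewrite val_eqE (negbTE xy) cxy eqxx.
Qed.

(* A Gram representation of the induced subgraph of H on the 5-cycle
   2-4-5-7-8 and the vertex 9: the 5-cycle receives the five cyclic shifts of
   (12, -1, 6, 6, -1), which is orthogonal to its shift by one place, and 9 a
   multiple of their sum. *)
Definition gram_vectors : seq (seq int) :=
  [:: [:: 0; 0; 12; 0; -1; 6; 0; 6; -1; 10];
      [:: 0; 0; -1; 0; 12; -1; 0; 6; 6; 10];
      [:: 0; 0; 6; 0; -1; 12; 0; -1; 6; 10];
      [:: 0; 0; 6; 0; 6; -1; 0; 12; -1; 10];
      [:: 0; 0; -1; 0; 6; 6; 0; -1; 12; 10]].

(** Each row of [gram_vectors] sums to 32 and has squared norm 318, whence 5 * 32^2 / (5 * 318) =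
    512/159, a rational number just below 1 + sqrt 5, the theta value of C5 + K1. *)
Lemma theta_ge_coneH (R : realType) m : 512 / 159 <= theta R (@cone m edgesH).
Proof.
pose v l i : int := nth 0 (nth [::] gram_vectors l) i.
pose V : 'M[R]_(5, 10 + m) := \matrix_(l, i) (v l i)%:~R.
(* Reading past the end of a row returns 0, so the apexes carry the zero vector. *)
have v0 l i : (l < 5)%N -> (10 <= i)%N -> v l i = 0.
  by move=> l5 i10; rewrite /v nth_default //; case: l l5 => [|[|[|[|[|]]]]].
have orth i j : (i < 10)%N -> (j < 10)%N -> cone_rel edgesH i j ==>
    (foldr (fun l s => v l i * v l j + s) 0 (iota 0 5) == 0).
  by move: i j; apply: all2_iota_lt; vm_compute.
have sumV (l : 'I_5) (F : int -> int) : F 0 = 0 ->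
    \sum_(i < 10 + m) (F (v l i))%:~R =
    (foldr (fun i s => F (v l i) + s) 0 (iota 0 10))%:~R :> R.
  move=> F0; transitivity (\sum_(i < 10) (F (v l i))%:~R : R).
    rewrite big_split_ord /= [X in _ + X]big1 ?addr0 // => i _.
    by rewrite v0 ?leq_addr // F0.
  rewrite -rmorph_sum; congr (_%:~R).
  exact: (big_ord_foldr +%R 0 _ (fun i => F (v l i))).
have num : \sum_l (\sum_i V l i) ^+ 2 = 5120.
  under eq_bigr => l _ do under eq_bigr => i _ do rewrite mxE.
  under eq_bigr => l _ do rewrite (sumV l id) // -rmorphXn.
  rewrite -rmorph_sum (big_ord_foldr +%R 0 _ (fun l =>
    (foldr (fun i s => id (v l i) + s) 0 (iota 0 10)) ^+ 2)).
  set t := foldr _ _ _; have -> : t = 5120%:Z by vm_compute.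
  by [].
have den : \sum_l \sum_i V l i ^+ 2 = 1590.
  under eq_bigr => l _ do under eq_bigr => i _ do rewrite mxE -rmorphXn.
  under eq_bigr => l _ do rewrite (sumV l (fun z => z ^+ 2)) //.
  rewrite -rmorph_sum (big_ord_foldr +%R 0 _ (fun l =>
    (foldr (fun i s => (v l i) ^+ 2 + s) 0 (iota 0 10)))).
  set t := foldr _ _ _; have -> : t = 1590%:Z by vm_compute.
  by [].
have -> : 512 / 159 = (\sum_l (\sum_i V l i) ^+ 2) /
    (\sum_l \sum_i V l i ^+ 2) :> R by rewrite num den; field.
apply: theta_ge_gram; last by rewrite den ltr0n.
move=> i j Hij; under eq_bigr => l _ do rewrite !mxE -rmorphM.
have [i10|i10] := ltnP i 10; last first.
  by rewrite big1 // => l _; rewrite v0 // mul0r.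
have [j10|j10] := ltnP j 10; last first.
  by rewrite big1 // => l _; rewrite [v l j]v0 // mulr0.
rewrite -rmorph_sum (big_ord_foldr +%R 0 _ (fun l => v l i * v l j)).
by have /implyP/(_ Hij)/eqP -> := orth i j i10 j10.
Qed.

(** * Cospectrality of the two joins and conclusion *)

(** Outside the switching clique, the vertices 4..9 see exactly half of it and the apexes all of
    it. *)
Lemma cones_cospectral (R : realType) m :
  let G := @cone m edgesG in let H := @cone m edgesH in
  [/\ cospectral (adjmx R G) (adjmx R H),
      cospectral (laplacian R G) (laplacian R H),
      cospectral (signless_laplacian R G) (signless_laplacian R H) &
      cospectral (norm_laplacian R G) (norm_laplacian R H)].
Proof.
move=> G H; pose C := [set i : 'I_(10 + m) | (i < 4)%N].
have sumC (F : nat -> nat) :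
    (\sum_(k in C) F k = foldr (fun k s => F k + s) 0 (iota 0 4))%N.
  rewrite -big_ord_foldr (big_ord_widen (10 + m) F) ?leq_addr //.
  by apply: eq_bigl => k; rewrite inE.
have cardC : #|C| = 4%N by rewrite -sum1_card (sumC (fun=> 1%N)).
apply: (@switching_cospectral R _ C); rewrite ?cardC //; try exact: cone_sym.
- have eqGH : forall x y, (x < 10)%N -> (y < 10)%N ->
      ((x < 4) == (y < 4))%N ==> (cone_rel edgesG x y == cone_rel edgesH x y).
    by apply: all2_iota_lt; vm_compute.
  move=> i j; rewrite !inE => ij.
  have [i10|i10] := ltnP i 10; last by rewrite /G /H !cone_apex ?i10.
  have [j10|j10] := ltnP j 10; last by rewrite /G /H !cone_apex ?j10 ?orbT.
  by have := eqGH i j i10 j10; rewrite ij eqxx => /eqP.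
- move=> i j; rewrite !inE => i4 j4.
  rewrite (sumC (fun k => cone_rel edgesG i k)).
  rewrite (sumC (fun k => cone_rel edgesG j k)); apply/eqP.
  by move: (nat_of_ord i) (nat_of_ord j) i4 j4; apply: all2_iota_lt; vm_compute.
- move=> i j; rewrite !inE -leqNgt => i4 j4.
  rewrite (sumC (fun k => cone_rel edgesG k j)).
  have [j10|j10] := ltnP j 10.
    have half : forall x y, (x < 10)%N -> (y < 10)%N -> (x < 4 <= y)%N ==>
        (foldr (fun k s => cone_rel edgesG k y + s) 0 (iota 0 4) * 2 ==
         4 * (cone_rel edgesG x y + cone_rel edgesH x y))%N.
      by apply: all2_iota_lt; vm_compute.
    have i10 : (i < 10)%N by apply: leq_trans i4 _.
    by have /implyP := half i j i10 j10; rewrite i4 j4 => /(_ isT)/eqP.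
  (* An apex is adjacent to all of [C] in both graphs, so the identity reads 4 * 2 = 4 * (1 + 1). *)
  have apex e k : (k < 4)%N -> cone_rel e k j = true.
    move=> k4; rewrite /cone_rel [(j < 10)%N]ltnNge j10 andbF.
    by rewrite (ltn_eqF (leq_trans k4 j4)).
  by rewrite /G /H /cone /= !apex.
- have degGH : forall x, (x < 10)%N ->
      (foldr (fun y s => cone_rel edgesG x y + s) 0 (iota 0 10) ==
       foldr (fun y s => cone_rel edgesH x y + s) 0 (iota 0 10))%N.
    by apply: all_iota_lt; vm_compute.
  by move=> i; rewrite !deg_cone; case: ltnP => // /degGH /eqP ->.
- move=> i j; rewrite !inE => i4 j4; rewrite !deg_cone.
  rewrite (leq_trans i4) // (leq_trans j4) //; congr (_ + _)%N; apply/eqP.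
  by move: (nat_of_ord i) (nat_of_ord j) i4 j4; apply: all2_iota_lt; vm_compute.
Qed.

(** In both graphs the vertices 0 and 9 have 6 and 2 neighbours in the core. *)
Lemma irregular_cone m e :
  (foldr (fun y s => cone_rel e 0 y + s) 0 (iota 0 10) !=
   foldr (fun y s => cone_rel e 9 y + s) 0 (iota 0 10))%N ->
  irregular (@cone m e).
Proof.
move=> d09; exists (@Ordinal (10 + m) 0 isT), (@Ordinal (10 + m) 9 isT).
by rewrite !deg_cone; move/eqP: d09 => d09 /addIn /d09.
Qed.

Theorem mainTheorem4 (R : realType) (n : nat) :
  (14 <= n)%N -> ~~ odd n ->
  exists G H : rel 'I_n,
    [/\ simple_graph G /\ simple_graph H,
        [/\ connected_graph G, connected_graph H,
            irregular G, irregular H & ~ isomorphic G H],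
        [/\ cospectral (adjmx R G) (adjmx R H),
            cospectral (laplacian R G) (laplacian R H),
            cospectral (signless_laplacian R G) (signless_laplacian R H) &
            cospectral (norm_laplacian R G) (norm_laplacian R H)],
        [/\ alpha G = alpha H, omega G = omega H & chi G = chi H] &
        theta R G <> theta R H].
Proof.
move=> n14 _; have [m m0 ->] : exists2 m, (0 < m)%N & n = (10 + m)%N.
  by exists (n - 10)%N; lia.
have thG := @theta_le_coneG R m (cone edgesG).
have thH := @theta_ge_coneH R m.
exists (@cone m edgesG), (@cone m edgesH); split.
- by split; split; (exact: cone_sym || exact: cone_irr).
- split; try (exact: connected_cone || exact: irregular_cone).
  (* An isomorphism would carry the cover by three cliques over to H. *)
  move=> [f fP]; have : theta R (@cone m edgesH) <= 3.
    by apply: theta_le_coneG; exists f => x y; rewrite fP.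
  by move=> /(le_trans thH); lra.
- exact: cones_cospectral.
(* The lists are proper 4-colourings of the cores, with colour i on each vertex i < 4. *)
- have [-> ->] := @omega_chi_cone m edgesG [:: 0; 1; 2; 3; 2; 3; 1; 0; 2; 0]%N
    isT isT isT isT.
  have [-> ->] := @omega_chi_cone m edgesH [:: 0; 1; 2; 3; 1; 0; 3; 2; 1; 2]%N
    isT isT isT isT.
  (* The triple 4, 7, 9 avoids the switching clique, so it is independent in both graphs or in
     neither. *)
  have -> : alpha (@cone m edgesG) = 3%N.
    by apply: (@alpha_cone _ _ 4 7 9); vm_compute.
  have -> : alpha (@cone m edgesH) = 3%N.
    by apply: (@alpha_cone _ _ 4 7 9); vm_compute.
  by [].
- have : theta R (@cone m edgesG) <= 3.
    by apply: thG; exists 1%g => x y; rewrite !permE.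
  by move=> + E; rewrite E => /(le_trans thH); lra.
Qed.
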